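(* Let $G$ be a finite abelian group of order $n$ (written additively) and let $S$ be a sequence over $G$ with $|S|=n$. Suppose there is a unique integer $r\in[1,n]$ such that $0\in\Sigma_r(S)$. Then $|\mathrm{supp}(S)|\le 2$. Moreover: (A) If $G$ is non-cyclic, then there are $g,h\in G$ and an integer $m\geq 1$ with $\mathrm{ord}(g)=\frac n2=2m$, $\mathrm{ord}(h)=2$, $h\in G\setminus\langle g\rangle$, such that $G=\langle h\rangle\oplus\langle g\rangle\cong C_2\oplus C_{2m}$, $r=\frac n2=2m$, and one of the following holds: $$S=g^{n-1}g' \quad\text{for some } g'\in G\setminus\langle g\rangle;$$ $$S=g^{n/2+x}(h+g)^{n/2-x}\quad\text{for some odd integer } x\in[1,\tfrac n2-1];$$ $$S=g^{n/2+x}\left(h+\tfrac{n+4}{4}g\right)^{n/2-x}\quad\text{for some odd integer } x\in[1,\tfrac n2-1].$$ (B) If $G$ is cyclic (so $G\cong C_n$), then there exists a generator $g\in G$ such that one of the following holds: (1) $S=g^{n-1}g'$ for some $g'\in G$; (2) $S=(2g)^{n-1}g''$ for some $g''\in G\setminus\langle 2g\rangle$; (3) $n$ is odd, $r=\frac{n+1}{2}$ and $S=g^{n-2}\left(\frac{n+1}{2}g\right)^2$; (4) $n\equiv 2 \pmod 4$, $r=\frac n2$ and $S=(2g)^{n/2+x}\left(\frac{n+4}{2}g\right)^{n/2-x}$ for some even integer $x\in[0,\frac n2-1]$; (5) $n$ is even, $r=\frac n2$ and $S=g^{n/2+x}\left(\frac{n+2}{2}g\right)^{n/2-x}$ for some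 integer $x\in[0,\frac n2-1]$ with $\frac n2-x$ odd.
   Context: A sequence over an abelian group $G$ is a finite multiset of elements of $G$ (an element of the free abelian monoid with basis $G$), written multiplicatively: $S=s_1\cdots s_r=\prod_{g\in G}g^{v_g(S)}$, where $v_g(S)\ge 0$ is the multiplicity of $g$ in $S$. So $g^k$ means the element $g$ repeated $k$ times, juxtaposition means multiset union, and e.g. $(kg)^j$ means the group element $kg$ repeated $j$ times. The length is $|S|=\sum_{g}v_g(S)$ and the support is $\mathrm{supp}(S)=\{g\in G: v_g(S)>0\}$. A subsequence $T\mid S$ is a sub-multiset, i.e. $v_g(T)\le v_g(S)$ for all $g$. The sum is $\sigma(S)=\sum_{g\in G}v_g(S)g$. For an integer $k\geq 1$, $\Sigma_k(S)=\{\sigma(T): T\mid S,\ |T|=k\}$. $C_n$ is the cyclic group of order $n$, $\mathrm{ord}(g)$ is the order of $g$, $\langle g\rangle$ is the subgroup generated by $g$, and $[a,b]$ denotes the set of integers $x$ with $a\le x\le b$. *)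

(* Defs.v *)
From mathcomp Require Import all_boot all_order all_algebra all_fingroup all_solvable.
From mathcomp Require Import finmap multiset.

Set Implicit Arguments.
Unset Strict Implicit.
Unset Printing Implicit Defensive.

Local Open Scope mset_scope.

(* A sequence over G is a multiset S : {mset G}: v_g(S) is S g, the power g^k
   is msetn k g, juxtaposition is `+`, divisibility is `<=`, the support is
   finsupp S, and the length is size S (S coerces to the list of its elements,
   repeated with multiplicity). *)

Definition sigma (G : finZmodType) (S : {mset G}) : G :=
  (\sum_(g <- finsupp S) g *+ S g)%R.

Definition Sigma (G : finZmodType) (k : nat) (S : {mset G}) (x : G) : Prop :=
  exists T : {mset G}, [/\ T `<=` S, size T = k & sigma T = x].

(* Main.v *)
Require Import Defs.
From mathcomp Require Import all_boot all_order all_algebra all_fingroup all_solvable.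
From mathcomp Require Import finmap multiset zify.

(* Index the terms of S by I, so that subsequences become sets A of indices, and
   let n = |G|.  All nonempty zero-sum A have the same size r; in particular no
   two of them are disjoint.
   - Scherk's theorem (|A+B| >= |A|+|B|-1 if 0 = 0+0 is the only representation
     of 0 in A+B) yields a zero-sum of length at most h, the largest
     multiplicity of a term; hence r <= h.
   - If 2r < n, the complement of a zero-sum T is zero-sum free of length
     n - r > n/2.  By the Savchev-Chen theorem its terms are positive multiples
     x_i e of a generator e, with sum x_i < n.  Exchanging parts of T with parts
     of the complement of equal sum preserves lengths, which forces all terms but
     one to be e.
   - If 2r >= n, let g have multiplicity h >= n/2 and order o.  If o <= h then
     r = o, and counting modulo <g> leaves only index at most 2.  If o > h then
     g generates G; completing a partial sum by copies of g determines its
     length, so that the other terms are all equal. *)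

Set Implicit Arguments.
Unset Strict Implicit.
Unset Printing Implicit Defensive.

Local Open Scope nat_scope.

Import GRing.Theory FinRing.Theory.

(** * Scherk's theorem on sumsets *)

Lemma scherk (G : finZmodType) (A B : {set G}) :
  0%R \in A -> 0%R \in B ->
  (forall a b, a \in A -> b \in B -> (a + b)%R = 0%R -> a = 0%R /\ b = 0%R) ->
  #|A| + #|B| <= #|[set (a + b)%R | a in A, b in B]|.+1.
Proof.
elim: {B}_.+1 {-2}B (ltnSn #|B|) A => // m IHm B leBm A A0 B0 AB0.
have [/subsetP B1 | /subsetPn[b Bb]] := boolP (B \subset [set 0%R : G]).
  have ->: B = [set 0%R].
    by apply/eqP; rewrite eqEsubset sub1set B0 andbT; apply/subsetP.
  rewrite cards1 addn1 ltnS subset_leq_card //; apply/subsetP => a Aa.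
  by apply/imset2P; exists a 0%R; rewrite ?inE ?addr0.
rewrite inE => b_neq0.
(* If [A + b] were inside [A], it would equal [A] by cardinality, so [0 = a + b] for some [a] in
   [A], although [b != 0]. *)
have [a Aa abA] : exists2 a, a \in A & (a + b)%R \notin A.
  apply/subsetPn/negP => /subsetP sub.
  have sAb: [set (a + b)%R | a in A] \subset A.
    by apply/subsetP => _ /imsetP[a Aa ->]; apply: sub.
  have eqA: [set (a + b)%R | a in A] = A.
    by apply/eqP; rewrite eqEcard sAb card_imset //=; exact: addIr.
  move: A0; rewrite -eqA => /imsetP[a Aa ab0].
  by case: (AB0 a b Aa Bb (esym ab0)) => _ b0; rewrite b0 eqxx in b_neq0.
(* The Dyson transform at [a] enlarges [A], shrinks [B] and keeps [#|A| + #|B|]. *)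
set aB := [set (a + c)%R | c in B].
set B' := [set c in B | (a + c)%R \in A].
have cardAB : #|A :|: aB| + #|B'| = #|A| + #|B|.
  have <-: #|aB| = #|B| by apply/card_imset/addrI.
  rewrite -(cardsUI A aB); congr (_ + _).
  have <-: #|[set (a + c)%R | c in B']| = #|B'| by apply/card_imset/addrI.
  apply: eq_card => x; rewrite [RHS]inE.
  apply/imsetP/andP => [[c]|[Ax /imsetP[c Bc xE]]].
    by rewrite inE => /andP[Bc Aac] ->; split=> //; apply/imsetP; exists c.
  by exists c => //; rewrite inE Bc -xE Ax.
have ltB' : #|B'| < #|B|.
  apply/proper_card/properP; split; first by apply/subsetP => c /setIdP[].
  by exists b; rewrite // inE Bb (negPf abA).
rewrite -cardAB (leq_trans (IHm _ _ (A :|: aB) _ _ _)) //.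
- exact: leq_trans ltB' leBm.
- by rewrite inE A0.
- by rewrite inE B0 addr0.
(* The representation of 0 stays unique: if [(a + d) + c = 0] with [a + c] in [A], then
   [(a + c) + d = 0] gives [a + c = 0] and [d = 0], and the former gives [a = c = 0]. *)
- move=> x c /setUP[Ax | /imsetP[d Bd ->]] /setIdP[Bc Aac] xc0.
    exact: AB0.
  have [|ac0 d0] := AB0 _ _ Aac Bd; first by rewrite addrAC.
  have [a0 c0] := AB0 _ _ Aa Bc ac0.
  by rewrite a0 d0 addr0.
- rewrite ltnS subset_leq_card //; apply/subsetP => y /imset2P[x c].
  move=> /setUP[Ax | /imsetP[d Bd ->]] /setIdP[Bc Aac] ->; apply/imset2P.
    by exists x c.
  by exists (a + c)%R d => //; rewrite addrAC.
Qed.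

(** * Subset sums of an indexed family *)

Section SubsetSums.

Variables (G : finZmodType) (I : finType) (f : I -> G).
Implicit Types (A B U V : {set I}) (K : {group G}).

Definition ssum A : G := (\sum_(i in A) f i)%R.

Definition subsums U : {set G} := [set ssum A | A in powerset U].

Definition zero_sum_free U := forall A, A \subset U -> ssum A = 0%R -> A = set0.

Lemma ssum0 : ssum set0 = 0%R.
Proof. exact: big_set0. Qed.

Lemma ssum1 i : ssum [set i] = f i.
Proof. exact: big_set1. Qed.

Lemma ssumU A B : [disjoint A & B] -> ssum (A :|: B) = (ssum A + ssum B)%R.
Proof. by move=> dAB; rewrite /ssum -bigU //=; apply: eq_bigl => i; rewrite inE. Qed.

Lemma ssumU1 i A : i \notin A -> ssum (i |: A) = (f i + ssum A)%R.
Proof. exact: big_setU1. Qed.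

Lemma ssumD A B : B \subset A -> ssum (A :\: B) = (ssum A - ssum B)%R.
Proof.
by move=> sBA; rewrite /ssum [in RHS](big_setID B)
   (setIidPr sBA) /= [X in (X - _)%R]addrC addrK.
Qed.

Lemma ssum_const e A :
  (forall i, i \in A -> f i = e) -> ssum A = (e *+ #|A|)%R.
Proof. by move=> fA; rewrite /ssum (eq_bigr _ fA) sumr_const. Qed.

Lemma ssum_mulrn e (x : I -> nat) A :
  (forall i, i \in A -> f i = (e *+ x i)%R) ->
  ssum A = (e *+ \sum_(i in A) x i)%R.
Proof. by move=> fA; rewrite /ssum (eq_bigr _ fA) sumrMnr. Qed.

Lemma subsumsP U a :
  reflect (exists2 A : {set I}, A \subset U & a = ssum A) (a \in subsums U).
Proof.
by apply: (iffP imsetP) => -[A sAU ->]; exists A; rewrite ?powersetE in sAU *.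
Qed.

Lemma mem_subsums A U : A \subset U -> ssum A \in subsums U.
Proof. by move=> sAU; apply/subsumsP; exists A. Qed.

Lemma subsums0 U : 0%R \in subsums U.
Proof. by rewrite -ssum0 mem_subsums ?sub0set. Qed.

Lemma subsums_sub U V : U \subset V -> subsums U \subset subsums V.
Proof.
move=> sUV; apply/subsetP => _ /subsumsP[A sAU ->].
exact: mem_subsums (subset_trans sAU sUV).
Qed.

Lemma zero_sum_free_sub U V :
  U \subset V -> zero_sum_free V -> zero_sum_free U.
Proof. by move=> sUV zV A sAU; apply/zV/(subset_trans sAU). Qed.

Lemma subsums_sym U a : a \in subsums U -> (ssum U - a)%R \in subsums U.
Proof.
by move=> /subsumsP[A sAU ->]; rewrite -ssumD // mem_subsums ?subsetDl.
Qed.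

Lemma subsumsD1 U i : i \in U ->
  subsums U = subsums (U :\ i) :|: [set (f i + a)%R | a in subsums (U :\ i)].
Proof.
move=> Ui; apply/setP=> a; rewrite inE; apply/subsumsP/orP => [[A sAU ->]|].
  have [Ai | nAi] := boolP (i \in A); last first.
    by left; apply: mem_subsums; rewrite subsetD1 sAU.
  right; apply/imsetP; exists (ssum (A :\ i)).
    by apply: mem_subsums; rewrite setSD.
  by rewrite -ssumU1 ?setD11 // setD1K.
case=> [/subsumsP[A] | /imsetP[_ /subsumsP[A] + ->] ->].
  by rewrite subsetD1 => /andP[sAU _] ->; exists A.
rewrite subsetD1 => /andP[sAU nAi]; exists (i |: A); last by rewrite ssumU1.
by rewrite subUset sub1set Ui.
Qed.

Lemma subsumsN U i : zero_sum_free U -> i \in U -> (- f i)%R \notin subsums (U :\ i).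
Proof.
move=> zU Ui; apply/subsumsP => -[A]; rewrite subsetD1 => /andP[sAU nAi] fA.
have : i |: A = set0.
  by apply: zU; [rewrite subUset sub1set Ui | rewrite ssumU1 // -fA subrr].
by move/setP/(_ i); rewrite !inE eqxx.
Qed.

(* Adding one more term [i] adds the whole coset of [ssum U], since it misses
   the cosets already met. *)
Lemma card_sums_mod K U :
  (forall A, A \subset U -> ssum A \in K -> A = set0) -> #|U|.+1 * #|K| <= #|G|.
Proof.
move=> zU.
suff: #|U|.+1 * #|K| <= #|[set (a + k)%R | a in subsums U, k in K]|.
  by move/leq_trans; apply; apply: max_card.
elim: {U}_.+1 {-2}U (ltnSn #|U|) zU => // m IHm U leUm zU.
have [-> | [i Ui]] := set_0Vmem U.
  rewrite cards0 mul1n subset_leq_card //; apply/subsetP => k Kk.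
  by apply/imset2P; exists 0%R k; rewrite ?subsums0 ?add0r.
set Y := (X in _ <= #|pred_of_set X|).
set Y' := [set (a + k)%R | a in subsums (U :\ i), k in K].
set C := [set (ssum U + k)%R | k in K].
have Y'le : #|U| * #|K| <= #|Y'|.
  have cardU : #|U| = #|U :\ i|.+1 by rewrite (cardsD1 i) Ui.
  rewrite cardU; apply: IHm; first by rewrite -ltnS -cardU.
  by move=> A sAU; apply: zU; apply: subset_trans sAU (subsetDl _ _).
have Cle : #|C| = #|K| by apply/card_imset/addrI.
have dYC : [disjoint Y' & C].
  rewrite -setI_eq0; apply/eqP/setP=> y; rewrite !inE; apply/andP.
  case=> /imset2P[_ k /subsumsP[A + ->] Kk ->] /imsetP[k' Kk'].
  rewrite subsetD1 => /andP[sAU nAi] eqk.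
  have /setP/(_ i) : U :\: A = set0.
    apply: zU; first exact: subsetDl.
    rewrite ssumD //; suff -> : (ssum U - ssum A = k - k')%R by apply: groupM; rewrite ?groupV.
    by apply/eqP; rewrite subr_eq addrAC eq_sym subr_eq -eqk addrC.
  by rewrite !inE Ui nAi.
rewrite mulSn addnC (leq_trans (leq_add Y'le (leqnn _))) // -Cle.
move: dYC; rewrite -(leq_card_setU Y' C) => /eqP <-.
apply/subset_leq_card; rewrite subUset; apply/andP; split; apply/subsetP.
  move=> _ /imset2P[a k aU Kk ->]; apply/imset2P; exists a k => //.
  exact: subsetP (subsums_sub (subsetDl _ _)) _ aU.
move=> _ /imsetP[k Kk ->]; apply/imset2P; exists (ssum U) k => //.
exact: mem_subsums.
Qed.

End SubsetSums.

(** * Lengths of zero-sums and structure of zero-sum free sets *)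

Lemma ex_subset_card (T : finType) (U : {set T}) k :
  k <= #|U| -> exists2 A : {set T}, A \subset U & #|A| = k.
Proof.
move=> lekU; exists [set x in take k (enum U)].
  by apply/subsetP => x; rewrite inE => /mem_take; rewrite mem_enum.
by rewrite cardsE (card_uniqP _) ?take_uniq ?enum_uniq // size_takel // -cardE.
Qed.

Lemma mulrn_eq0_order (G : finZmodType) (e : G) k :
  (e *+ k == 0)%R = (#[e]%g %| k).
Proof. by rewrite order_dvdn zmodXgE zmod1gE. Qed.

Lemma eq_mulrn_order (G : finZmodType) (e : G) k l :
  (e *+ k == e *+ l)%R = (k == l %[mod #[e]%g]).
Proof. by rewrite -eq_expg_mod_order !zmodXgE. Qed.

Lemma mulrn_small_inj (G : finZmodType) (e : G) k l :
  k < #[e]%g -> l < #[e]%g -> (e *+ k)%R = (e *+ l)%R -> k = l.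
Proof. by move=> lek lel /eqP; rewrite eq_mulrn_order !modn_small // => /eqP. Qed.

Lemma opp_mulrn_order (G : finZmodType) (e : G) k :
  k <= #[e]%g -> (- (e *+ k))%R = (e *+ (#[e]%g - k))%R.
Proof.
move=> lek; apply/eqP; rewrite eq_sym -addr_eq0 -mulrnDr subnK //.
by rewrite mulrn_eq0_order.
Qed.

Section Bounds.

Variables (G : finZmodType) (I : finType) (f : I -> G).
Implicit Types (A B U V : {set I}).

(* Colour the index set with [h] colours so that [f] is injective on each colour
   class.  If no nonempty zero-sum had at most [h] terms, Scherk's theorem
   applied to the sets [{0} + f(class)] would produce more than [#|G|] sums. *)
Lemma short_zero_sum h :
  (forall a, #|[set i | f i == a]| <= h) -> #|G| <= #|I| ->
  exists A, [/\ A != set0, #|A| <= h & ssum f A = 0%R].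
Proof.
move=> mult_le leGI.
pose P A := [&& A != set0, #|A| <= h & ssum f A == 0%R].
have [/existsP[A /and3P[A0 leA /eqP sA]] | noA] := boolP [exists A, P A].
  by exists A.
have {noA} noA A : #|A| <= h -> ssum f A = 0%R -> A = set0.
  move=> leA sA; apply/eqP; apply: contraNT noA => A0; apply/existsP; exists A.
  by rewrite /P A0 leA sA eqxx.
pose fib a := [set i | f i == a].
(* The colour of [i] is its rank in its fibre: it is below [h], and distinct indices of equal value
   get distinct colours. *)
pose c i := index i (enum (fib (f i))).
have c_lt i : c i < h.
  by rewrite (leq_trans _ (mult_le (f i))) // cardE index_mem mem_enum inE.
have c_inj i j : f i = f j -> c i = c j -> i = j.
  move=> fij; rewrite /c fij => cij.
  rewrite -(nth_index i (_ : i \in enum (fib (f j)))); last first.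
    by rewrite mem_enum inE fij.
  by rewrite cij nth_index // mem_enum inE.
(* Each new colour class contributes at most one term, so the sums in [D j] have at most [j <= h]
   terms and [noA] applies to them. At [j = h] the claim reads [#|I| < #|D h|], which exceeds
   [#|G|]. *)
pose D j := [set ssum f A |
  A in [set A : {set I} | (A \subset [set i | c i < j]) && (#|A| <= j)]].
suff claim j : j <= h -> #|[set i | c i < j]| < #|D j|.
  have := claim h (leqnn h).
  have -> : [set i | c i < h] = setT by apply/setP=> i; rewrite !inE c_lt.
  by rewrite cardsT ltnNge (leq_trans _ leGI) ?max_card.
elim: j => [_|j IHj lt_jh].
  have -> : [set i | c i < 0] = set0 by apply/setP=> i; rewrite !inE.
  rewrite cards0; apply/card_gt0P; exists 0%R; apply/imsetP; exists set0.
    by rewrite inE sub0set cards0.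
  by rewrite ssum0.
pose C := [set i | c i == j].
have cardC : #|[set i | c i < j.+1]| = #|[set i | c i < j]| + #|C|.
  rewrite -cardsUI [_ :&: _](_ : _ = set0) ?cards0 ?addn0.
    by apply: eq_card => i; rewrite !inE ltnS leq_eqVlt orbC.
  by apply/setP=> i; rewrite !inE; case: eqP => [->|]; rewrite ?ltnn ?andbF.
have cardY : #|0%R |: [set f i | i in C]| = #|C|.+1.
  rewrite cardsU1 card_in_imset; last first.
    by move=> i k; rewrite !inE => /eqP ci /eqP ck /c_inj; apply; rewrite ci ck.
  rewrite (_ : _ \notin _) //; apply/imsetP => -[i _ fi].
  have /setP/(_ i) : [set i] = set0.
    by apply: noA; rewrite ?cards1 ?ssum1 // (leq_trans _ lt_jh).
  by rewrite !inE eqxx.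
rewrite cardC -ltnS -addnS -cardY.
have D0 : 0%R \in D j.
  by apply/imsetP; exists set0; rewrite ?ssum0 // inE sub0set cards0.
have UD A i : A \subset [set i | c i < j] -> c i = j -> i \notin A.
  move=> sA ci; apply/negP => /(subsetP sA).
  by rewrite inE ci ltnn.
have lt_Dj := IHj (ltnW lt_jh).
apply: (@leq_trans (#|D j| + #|0%R |: [set f i | i in C]|)).
  by rewrite -addSn leq_add2r.
apply: leq_trans (scherk D0 (setU11 _ _) _) _.
  move=> a b /imsetP[A]; rewrite inE => /andP[sA leA] ->.
  case/setU1P => [-> | /imsetP[i]]; first by rewrite addr0.
  rewrite inE => /eqP ci -> sum0; have nAi := UD A i sA ci.
  have /setP/(_ i) : i |: A = set0.
    by apply: noA; rewrite ?cardsU1 ?nAi ?ssumU1 // 1?addrC // (leq_trans _ lt_jh).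
  by rewrite !inE eqxx.
rewrite ltnS subset_leq_card //; apply/subsetP => y /imset2P[a b /imsetP[A]].
rewrite inE => /andP[sA leA] -> /setU1P[-> | /imsetP[i]] => [|+ ->] => [->|].
  apply/imsetP; exists A; rewrite ?addr0 // inE (leqW leA) andbT.
  by apply: subset_trans sA _; apply/subsetP => i; rewrite !inE; apply: leqW.
rewrite inE => /eqP ci ->; have nAi := UD A i sA ci.
apply/imsetP; exists (i |: A); last by rewrite ssumU1 // addrC.
rewrite inE cardsU1 nAi add1n ltnS leA andbT subUset sub1set inE ci ltnSn.
by apply: subset_trans sA _; apply/subsetP => k; rewrite !inE; apply: leqW.
Qed.

(* The inductive form of the Savchev--Chen structure theorem.  If deleting some
   term loses at least two sums, induct.  Otherwise deleting any term loses only
   the full sum [s], so every sum [a != s] can be increased, and dually every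
   [a != 0] decreased, by any term; for distinct terms [b], [c] this would make
   [b - c - b = - c] a subset sum, contradicting zero-sum freeness. *)
Lemma few_subsums_structure U :
  zero_sum_free f U -> #|subsums f U| < 2 * #|U| ->
  exists (e : G) (x : I -> nat),
    [/\ forall i, i \in U -> 0 < x i /\ f i = (e *+ x i)%R,
        \sum_(i in U) x i < #[e]%g
      & subsums f U = [set (e *+ (k : nat))%R | k : 'I_(\sum_(i in U) x i).+1]].
Proof.
elim: {U}_.+1 {-2}U (ltnSn #|U|) => // m IHm U leUm zU fewU.
have [/existsP[i /andP[Ui lossy]] | noloss] :=
    boolP [exists i in U, #|subsums f (U :\ i)|.+1 < #|subsums f U|].
  set X' := subsums f (U :\ i) in lossy.
  have cardU : #|U| = #|U :\ i|.+1 by rewrite (cardsD1 i) Ui.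
  have [| | |e [x [fx lts X'E]]] := IHm (U :\ i).
  - by rewrite -ltnS -cardU.
  - exact: zero_sum_free_sub (subsetDl _ _) zU.
  - by rewrite -/X'; lia.
  set s := (X in X < _) in lts; rewrite -/X' -/s in X'E.
  have X'P k : k <= s -> (e *+ k)%R \in X'.
    by rewrite -ltnS => lek; rewrite X'E; apply/imsetP; exists (Ordinal lek).
  have cardX' : #|X'| = s.+1.
    rewrite X'E card_imset ?card_ord // => k l kl; apply/val_inj.
    by apply: mulrn_small_inj kl; apply: leq_trans lts; apply: ltn_ord.
  have les : #|U :\ i| <= s.
    by rewrite -sum1_card /s leq_sum // => j /fx[].
  have := subsumsN zU Ui; rewrite -/X' => NX'.
  have UX' := subsumsD1 f Ui; rewrite -/X' in UX'.
  (* Both [X'] and [f i + X'] have [s + 1] elements, and their union has fewer than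
     [2 * #|U| <= 2 * (s + 1)], so they meet. *)
  have [k [l [lek lel kl]]] : exists k l, [/\ k <= s, l <= s & (f i + e *+ k)%R = (e *+ l)%R].
    have /set0Pn[y] : X' :&: [set (f i + a)%R | a in X'] != set0.
      rewrite -card_gt0 -(ltn_add2l #|X' :|: [set (f i + a)%R | a in X']|) addn0.
      have cardfX' : #|[set (f i + a)%R | a in X']| = s.+1.
        by rewrite -cardX'; apply/card_imset/addrI.
      by rewrite cardsUI -UX' cardX' cardfX'; lia.
    rewrite inE => /andP[+ /imsetP[a]]; rewrite !X'E.
    move=> /imsetP[l _ ->] /imsetP[k _ ->] kl; exists k, l.
    by split; rewrite ?kl // -ltnS ltn_ord.
  have lt_kl : k < l.
    rewrite ltnNge; apply: contra NX' => lelk.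
    have -> : (- f i)%R = (e *+ (k - l))%R.
      by rewrite mulrnBr // -kl opprD addrCA subrr addr0.
    by apply: X'P; lia.
  have fi : f i = (e *+ (l - k))%R by rewrite mulrnBr ?(ltnW lt_kl) // -kl addrK.
  (* Otherwise [- f i] would be a multiple of [e] with coefficient [#[e] - (l - k) <= s], hence a
     sum avoiding [i]. *)
  have lt_o : s + (l - k) < #[e]%g.
    rewrite ltnNge; apply: contra NX' => geo.
    by rewrite fi opp_mulrn_order; [apply: X'P|]; lia.
  exists e, (fun j => if j == i then l - k else x j).
  have -> : \sum_(j in U) (if j == i then l - k else x j) = s + (l - k).
    rewrite (big_setD1 i) //= eqxx addnC; congr (_ + _); apply: eq_bigr => j.
    by rewrite !inE => /andP[/negPf->].
  split=> // [j Uj|].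
    case: eqVneq => [-> | ji]; first by rewrite subn_gt0.
    by apply: fx; rewrite !inE ji.
  apply/setP=> y; rewrite UX' inE; apply/orP/imsetP => [[]|[j _ ->]].
  - rewrite X'E => /imsetP[j _ ->].
    have ltj : j < (s + (l - k)).+1 by case: j => j /=; lia.
    by exists (Ordinal ltj).
  - case/imsetP=> a; rewrite X'E => /imsetP[j _ ->] ->.
    have ltj : l - k + j < (s + (l - k)).+1 by case: j => j /=; lia.
    by exists (Ordinal ltj) => //=; rewrite mulrnDr fi.
  have [lejs | ltsj] := leqP j s; [left; exact: X'P | right].
  apply/imsetP; exists (e *+ (j - (l - k)))%R.
    by apply: X'P; case: j ltsj => j /=; lia.
  by rewrite fi -mulrnDr subnKC //; lia.
have {}noloss i : i \in U -> #|subsums f U| <= #|subsums f (U :\ i)|.+1.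
  move=> Ui; move: noloss; rewrite negb_exists => /forallP/(_ i).
  by rewrite Ui -leqNgt.
(* If the total of [U] were a sum avoiding [i], the symmetry of [subsums f (U :\ i)] would make
   [- f i] one too. So the total is the single element lost. *)
have sUE i : i \in U -> subsums f (U :\ i) = subsums f U :\ ssum f U.
  move=> Ui; apply/eqP; rewrite eqEcard; apply/andP; split; last first.
    by have := noloss i Ui; rewrite (cardsD1 (ssum f U)) mem_subsums.
  rewrite subsetD1 subsums_sub ?subsetDl //=.
  apply: contra (subsumsN zU Ui) => /subsums_sym.
  by rewrite (ssumD _ (_ : [set i] \subset U)) ?sub1set // ssum1 addrC addKr.
have up i a : i \in U -> a \in subsums f U -> a != ssum f U -> (f i + a)%R \in subsums f U.
  move=> Ui Ua aU; rewrite (subsumsD1 f Ui) inE; apply/orP; right.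
  by apply/imsetP; exists a; rewrite // sUE // !inE aU.
have down i a : i \in U -> a \in subsums f U -> a != 0%R -> (a - f i)%R \in subsums f U.
  move=> Ui Ua a0.
  have -> : (a - f i = ssum f U - (f i + (ssum f U - a)))%R.
    by rewrite opprD opprB addrCA [(ssum f U + _)%R]addrC subrK addrC.
  apply/subsums_sym/up => //; first exact: subsums_sym.
  by rewrite -subr_eq0 addrC addKr oppr_eq0.
have Uf i : i \in U -> f i \in subsums f U.
  by move=> Ui; rewrite -(ssum1 f) mem_subsums ?sub1set.
have Uf_neq0 i : i \in U -> f i != 0%R.
  move=> Ui; rewrite -(ssum1 f); apply/eqP => /zU; rewrite sub1set => /(_ Ui).
  by move/setP/(_ i); rewrite !inE eqxx.
(* Going down from [f i] by [f j] and then by [f i] shows that [- f j] is a sum. It is not a sum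
   avoiding [j], so it is the total. Exchanging roles, [- f i] is the total as well, which makes the
   two terms equal. *)
have Ufn i j : i \in U -> j \in U -> f i != f j -> (- f j)%R = ssum f U.
  move=> Ui Uj fij; have : (f i - f j - f i)%R \in subsums f U.
    by apply: (down i); rewrite ?subr_eq0 //; apply: (down j); rewrite ?Uf ?Uf_neq0.
  rewrite addrAC subrr add0r => Nfj; have := subsumsN zU Uj.
  by rewrite sUE // !inE Nfj andbT negbK => /eqP.
have Ueq i j : i \in U -> j \in U -> f i = f j.
  move=> Ui Uj; have [//|fij] := eqVneq (f i) (f j); apply: oppr_inj.
  by rewrite (Ufn i j) // (Ufn j i) // eq_sym.
have [U0 | [i Ui]] := set_0Vmem U; first by rewrite U0 cards0 in fewU.
have fU j : j \in U -> f j = f i by move=> Uj; apply: Ueq.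
exists (f i), (fun=> 1); rewrite sum1_card; split=> [j Uj||]; first by rewrite fU.
  rewrite ltnNge; apply/negP => /ex_subset_card[A sAU cA].
  have A0: A = set0.
    apply: zU => //; rewrite (@ssum_const _ _ _ (f i)) => [|j /(subsetP sAU)/fU//].
    by apply/eqP; rewrite mulrn_eq0_order cA.
  by have := order_gt0 (f i); rewrite -cA A0 cards0.
apply/setP=> y; apply/subsumsP/imsetP => [[A sAU ->]|[k _ ->]].
  have ltA : #|A| < #|U|.+1 by rewrite ltnS subset_leq_card.
  exists (Ordinal ltA) => //=; apply: ssum_const => j /(subsetP sAU).
  exact: fU.
have [A sAU cA] : exists2 A : {set I}, A \subset U & #|A| = k.
  by apply: ex_subset_card; rewrite -ltnS.
by exists A; rewrite // -cA; apply/esym/ssum_const => j /(subsetP sAU)/fU.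
Qed.

End Bounds.

(** * Sequences whose nonempty zero-sums all have length [r] *)

(** Deleting a term [x i > 1] keeps the total below twice the number of terms. The remaining total
    is at least [#|U| - 1] and [x i <= #|U|], so the sums without [i] and those with [i] leave no
    gap. *)
Lemma subset_sums_full (T : finType) (x : T -> nat) (U : {set T}) k :
  (forall i, i \in U -> 0 < x i) -> \sum_(i in U) x i < 2 * #|U| ->
  k <= \sum_(i in U) x i ->
  exists2 B : {set T}, B \subset U & \sum_(i in B) x i = k.
Proof.
elim: {U}_.+1 {-2}U (ltnSn #|U|) k => // m IHm U leUm k x_gt0 lt_sum le_k.
have [/existsP[i /andP[Ui xi]] | ones] := boolP [exists i in U, 1 < x i].
  have cardU : #|U| = #|U :\ i|.+1 by rewrite (cardsD1 i) Ui.
  have sumU : \sum_(j in U) x j = x i + \sum_(j in U :\ i) x j.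
    exact: big_setD1.
  have le_sum : #|U :\ i| <= \sum_(j in U :\ i) x j.
    by rewrite -sum1_card leq_sum // => j /setD1P[_ /x_gt0].
  have IH l : l <= \sum_(j in U :\ i) x j ->
      exists2 B : {set T}, B \subset U :\ i & \sum_(j in B) x j = l.
    by apply: IHm; [lia | move=> j /setD1P[_ /x_gt0] | lia].
  have [/IH[B] | ltk] := leqP k (\sum_(j in U :\ i) x j).
    by move/subset_trans/(_ (subsetDl _ _)) => sBU Bk; exists B.
  have [|B] := IH (k - x i); first lia.
  rewrite subsetD1 => /andP[sBU nBi] Bk; exists (i |: B).
    by rewrite subUset sub1set Ui.
  by rewrite big_setU1 //= Bk; lia.
have x1 i : i \in U -> x i = 1.
  move=> Ui; move: ones; rewrite negb_exists => /forallP/(_ i).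
  by rewrite Ui; have := x_gt0 i Ui; lia.
have [B sBU cB] : exists2 B : {set T}, B \subset U & #|B| = k.
  by apply: ex_subset_card; rewrite -sum1_card -(eq_bigr _ x1).
by exists B; rewrite // -cB -sum1_card; apply: eq_bigr => i /(subsetP sBU)/x1.
Qed.

Lemma cycle_mulrn (G : finZmodType) (g a : G) :
  a \in <[g]>%g -> exists c, 0 < c <= #[g]%g /\ a = (g *+ c)%R.
Proof.
case/cycleP => k ->; rewrite zmodXgE.
have [/eqP k0 | k0] := posnP (k %% #[g]%g).
  exists #[g]%g; rewrite order_gt0 leqnn; split=> //; apply/eqP.
  by rewrite eq_mulrn_order modnn.
exists (k %% #[g]%g); rewrite k0 ltnW ?ltn_mod ?order_gt0 //; split=> //.
by apply/eqP; rewrite eq_mulrn_order modn_mod.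
Qed.

Lemma order_card_cycle (G : finZmodType) (e : G) :
  #[e]%g = #|G| -> <[e]>%g = [set: G].
Proof. by move=> oe; apply/eqP; rewrite eqEcard subsetT cardsT -oe leqnn. Qed.

Section UniqueLength.

Variables (G : finZmodType) (I : finType) (f : I -> G) (r : nat).
Implicit Types (A B U V : {set I}).

Hypothesis card_I : #|I| = #|G|.
Hypothesis sum0_card : forall A, A != set0 -> ssum f A = 0%R -> #|A| = r.

(** Exchanging [A] for [B] in [T] gives the nonempty zero-sum [(T :\: A) :|: B], which again has
    length [r = #|T|]. *)
Lemma swap_card T A B :
  ssum f T = 0%R -> T != set0 -> A \subset T -> B \subset ~: T -> B != set0 ->
  ssum f A = ssum f B -> #|A| = #|B|.
Proof.
move=> sT T0 sAT sBT /set0Pn[i Bi] sAB.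
have dTB : [disjoint T :\: A & B].
  rewrite disjoint_sym disjoints_subset; apply: subset_trans sBT _.
  by rewrite setCS subsetDl.
have := sum0_card (A := (T :\: A) :|: B); rewrite ssumU // ssumD // sT sAB sub0r addNr.
have -> : (T :\: A) :|: B != set0 by apply/set0Pn; exists i; rewrite inE Bi orbT.
move=> /(_ isT erefl); rewrite cardsU disjoint_setI0 // cards0 subn0.
rewrite cardsD (setIidPr sAT) -(sum0_card T0 sT).
have := subset_leq_card sAT; lia.
Qed.

Lemma zero_sum_exists : exists2 T : {set I}, T != set0 & ssum f T = 0%R.
Proof.
have [|A [A0 _ sA]] := @short_zero_sum _ _ f #|I| _ (eq_leq (esym card_I)).
  by move=> a; apply: max_card.
by exists A.
Qed.

(** A nonempty zero-sum disjoint from [T] would, together with [T], form a zero-sum of length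
    [2 * r] instead of [r]. *)
Lemma setC_zero_sum_free T : T != set0 -> ssum f T = 0%R -> zero_sum_free f (~: T).
Proof.
move=> T0 sT A sAT sA; apply/eqP; apply: contraT => A0.
have dTA : [disjoint T & A] by rewrite disjoint_sym disjoints_subset.
have := sum0_card (A := T :|: A); rewrite setU_eq0 (negPf T0) ssumU // sT sA addr0.
move=> /(_ isT erefl); rewrite cardsU disjoint_setI0 // cards0 subn0.
rewrite (sum0_card T0 sT) (sum0_card A0 sA).
have := sum0_card T0 sT; rewrite -card_gt0 in T0; lia.
Qed.

Lemma structure_small_length :
  2 * r < #|G| ->
  exists (e : G) (i0 : I), #[e]%g = #|G| /\ forall i, i != i0 -> f i = e.
Proof.
move=> small_r; have [T T0 sT] := zero_sum_exists.
have cT := sum0_card T0 sT; have zU := setC_zero_sum_free T0 sT.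
have r_gt0 : 0 < r by rewrite -cT card_gt0.
set U := ~: T in zU; set n := #|G| in small_r *.
have cU : #|U| = n - r by rewrite cardsCs setCK cT card_I.
have [|e [x [fx lts XE]]] := few_subsums_structure zU.
  by rewrite cU; apply: (leq_ltn_trans (max_card _)); rewrite -/n; lia.
set s := (X in X < _) in lts XE.
have les : #|U| <= s by rewrite -sum1_card /s leq_sum // => j /fx[].
(* The order of [e] divides [n] and exceeds [s >= n - r > n / 2]. *)
have oe : #[e]%g = n.
  have := order_dvdG (in_setT e); rewrite cardsT -/n => /dvdnP[k nE].
  have : k < 2 by nia.
  by case: k nE => [|[|]] //; lia.
have memX k : k <= s -> exists2 B : {set I}, B \subset U & ssum f B = (e *+ k)%R.
  rewrite -ltnS => lek; have : (e *+ k)%R \in subsums f U.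
    by rewrite XE; apply/imsetP; exists (Ordinal lek).
  by case/subsumsP=> B sBU ->; exists B.
have sumB B : B \subset U -> ssum f B = (e *+ \sum_(i in B) x i)%R.
  by move=> sBU; apply: ssum_mulrn => i /(subsetP sBU)/fx[].
have leB B : B \subset U -> #|B| <= \sum_(i in B) x i <= s.
  move=> sBU; rewrite -sum1_card leq_sum => [|i /(subsetP sBU)/fx[]//].
  by rewrite /s [leqRHS](big_setID B) (setIidPr sBU) leq_addr.
have [y yP] : exists y : I -> nat, forall i, 0 < y i <= n /\ f i = (e *+ y i)%R.
  apply: (@fin_all_exists _ (fun=> nat) (fun i y => 0 < y <= n /\ f i = (e *+ y)%R)).
  by move=> i; rewrite -oe; apply: cycle_mulrn; rewrite order_card_cycle ?inE.
(* Suppose [1 < y i <= s]. Even without the set [J] of indices with coefficient [y i], the rest of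
   [U] has a subset [B] with coefficients summing to [y i]. Exchanging [i] for [B] forces [B] to be
   a singleton, whose index would then belong to [J]. *)
have small i : i \in T -> y i <= s -> y i = 1.
  move=> Ti les_y; have [/andP[y0 yn] fi] := yP i.
  apply/eqP; rewrite eqn_leq y0 andbT leqNgt; apply/negP => y1.
  pose J := [set u in U | x u == y i].
  have sJU : J \subset U by apply/subsetP => u /setIdP[].
  have sumU : s = #|J| * y i + \sum_(u in U :\: J) x u.
    rewrite /s (big_setID J) (setIidPr sJU) /=; congr (_ + _).
    by rewrite -sum_nat_const; apply: eq_bigr => u /setIdP[_ /eqP].
  have cUJ : #|U :\: J| = n - r - #|J| by rewrite cardsD (setIidPr sJU) cU.
  have /andP[leUJ _] := leB _ (subsetDl U J).
  have leJ := subset_leq_card sJU.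
  have [|||B sB Bk] := @subset_sums_full _ x (U :\: J) (y i).
  - by move=> u /setDP[/fx[]].
  - by rewrite cUJ; nia.
  - by case: #|J| => [|j] in sumU cUJ leJ *; nia.
  have sBU := subset_trans sB (subsetDl _ _).
  have B0 : B != set0 by apply/eqP => B0; rewrite B0 big_set0 in Bk; lia.
  have : #|[set i]| = #|B|.
    by apply: (@swap_card T); rewrite ?sub1set // ssum1 fi sumB // Bk.
  rewrite cards1 => /esym/eqP/cards1P[u Bu]; move: sB Bk; rewrite Bu sub1set big_set1.
  by move=> /setDP[Uu]; rewrite inE Uu /= => /eqP.
(* Here [n - y i <= s], so some [B] in [U] completes [i] to a zero-sum, with [#|B| = r - 1]. Both
   equations follow from [r - 1 <= n - y i < n - s <= r]. *)
have big i : i \in T -> s < y i -> s = n - r /\ y i = (n - r).+1.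
  move=> Ti lt_sy; have [/andP[y0 yn] fi] := yP i.
  have [|B sBU sB] := memX (n - y i); first by lia.
  have nBi : i \notin B by apply/negP => /(subsetP sBU); rewrite inE Ti.
  have := sum0_card (A := i |: B); rewrite cardsU1 nBi ssumU1 // fi sB -mulrnDr subnKC //.
  have -> : i |: B != set0 by apply/set0Pn; exists i; rewrite !inE eqxx.
  have /eqP -> : (e *+ n == 0)%R by rewrite mulrn_eq0_order oe.
  move=> /(_ isT erefl) cB; have /andP[] := leB B sBU.
  have -> : \sum_(j in B) x j = n - y i.
    apply: (@mulrn_small_inj _ e); rewrite -?sumB // oe; last lia.
    by have /andP[_] := leB B sBU; lia.
  by lia.
have [/existsP[i0 /andP[Ti0 lt_sy]] | nobig] := boolP [exists i in T, s < y i].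
  exists e, i0; split=> // j ji0; have [sE yi0] := big i0 Ti0 lt_sy.
  have [Tj | nTj] := boolP (j \in T); last first.
    have Uj : j \in U by rewrite inE.
    have [xj ->] := fx j Uj.
    have : s = x j + \sum_(u in U :\ j) x u by exact: big_setD1.
    have /andP[] := leB _ (subsetDl U [set j]).
    have : #|U| = #|U :\ j|.+1 by rewrite (cardsD1 j) Uj.
    by move=> *; rewrite (_ : x j = 1) //; lia.
  have [le_sy | lt_syj] := leqP (y j) s.
    by have [_ ->] := yP j; rewrite small.
  have [_ yj] := big j Tj lt_syj.
  (* Two large coefficients [n - r + 1] add up to [n - 2 * r + 2] modulo [n]. As [s = #|U|], all
     terms of [U] equal [e], and exchanging the pair for [n - 2 * r + 2] of them would give
     [n = 2 * r]. *)
  have sT2 : [set i0; j] \subset T by rewrite subUset !sub1set Ti0.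
  have r2 : 2 <= r.
    by have := subset_leq_card sT2; rewrite cards2 eq_sym ji0 cT.
  have [B sBU cB] : exists2 B : {set I}, B \subset U & #|B| = n - 2 * r + 2.
    by apply: ex_subset_card; rewrite cU; lia.
  have x1 u : u \in U -> f u = e.
    move=> Uu; have [xu ->] := fx u Uu.
    have : s = x u + \sum_(v in U :\ u) x v by exact: big_setD1.
    have /andP[] := leB _ (subsetDl U [set u]).
    have : #|U| = #|U :\ u|.+1 by rewrite (cardsD1 u) Uu.
    by move=> *; rewrite (_ : x u = 1) //; lia.
  have : #|[set i0; j]| = #|B|.
    apply: (@swap_card T) => //; first by rewrite -card_gt0; lia.
    rewrite ssumU1 ?inE 1?eq_sym // ssum1 (@ssum_const _ _ _ e) => [|u /(subsetP sBU)/x1//].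
    have [[_ ->] [_ ->]] := (yP i0, yP j); rewrite yi0 yj -mulrnDr cB.
    apply/eqP; rewrite eq_mulrn_order oe.
    by rewrite (_ : _ + _ = n - 2 * r + 2 + n) ?modnDr; lia.
  by rewrite cards2 eq_sym ji0 cB; lia.
(* Without a large coefficient, [T] consists of copies of [e], so that [e *+ r = 0] with
   [0 < r < n]. *)
have fT i : i \in T -> f i = e.
  move=> Ti; have [_ ->] := yP i; rewrite small //.
  by move: nobig; rewrite negb_exists => /forallP/(_ i); rewrite Ti -leqNgt.
move: sT; rewrite (ssum_const fT) => /eqP.
rewrite mulrn_eq0_order oe cT => /(dvdn_leq r_gt0); lia.
Qed.

End UniqueLength.

Lemma index2_addP (G : finZmodType) (K : {group G}) a b :
  #|G| = 2 * #|K| -> a \notin K -> b \notin K -> (a + b)%R \in K.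
Proof.
move=> cG Ka Kb; set C := [set (a + k)%R | k in K].
have dKC : [disjoint K & C].
  rewrite -setI_eq0; apply/eqP/setP => x; rewrite !inE; apply/andP.
  case=> Kx /imsetP[k Kk xE]; case/negP: Ka.
  have -> : (a = x - k)%R by rewrite xE addrK.
  by apply: groupM; rewrite ?groupV.
have KCT : K :|: C = setT.
  apply/eqP; rewrite eqEcard subsetT cardsT cardsU disjoint_setI0 // cards0 subn0.
  have -> : #|C| = #|K| by apply/card_imset/addrI.
  by rewrite cG mul2n addnn leqnn.
have : (- b)%R \in K :|: C by rewrite KCT inE.
rewrite inE => /orP[|/imsetP[k Kk bE]].
  by rewrite (groupV K b) (negPf Kb).
have -> : (a + b = - k)%R by rewrite -[b]opprK bE opprD addrA subrr sub0r.
by rewrite (groupV K k).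
Qed.

(** * Sequences with a term of large multiplicity *)

Section LargeLength.

Variables (G : finZmodType) (I : finType) (f : I -> G) (r : nat).
Implicit Types (A B U V : {set I}).

Hypothesis card_I : #|I| = #|G|.
Hypothesis sum0_card : forall A, A != set0 -> ssum f A = 0%R -> #|A| = r.

Lemma length_le_mult : exists g, r <= #|[set i | f i == g]|.
Proof.
pose mult a := #|[set i | f i == a]|.
case: (@arg_maxnP _ (0%R : G) xpredT mult isT) => g _ max_g; exists g.
have [|A [A0 leA sA]] := @short_zero_sum _ _ f (mult g) _ (eq_leq (esym card_I)).
  by move=> a; apply: max_g.
by rewrite -(sum0_card A0 sA).
Qed.

Section MaxMult.

Variable g : G.
Let F := [set i | f i == g].

Lemma sum_with_mult V A : V \subset ~: F -> A \subset F ->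
  #|V :|: A| = #|V| + #|A| /\ ssum f (V :|: A) = (ssum f V + g *+ #|A|)%R.
Proof.
move=> sVF sAF; have dVA : [disjoint V & A].
  by rewrite disjoints_subset (subset_trans sVF) // setCS.
rewrite ssumU // cardsU disjoint_setI0 // cards0 subn0; split=> //.
by rewrite (@ssum_const _ _ _ g A) // => i /(subsetP sAF); rewrite inE => /eqP.
Qed.

(** Padding [V] with copies of [g] turns knowledge of its sum into an equation for its length; the
    counting below rests on this. *)
Lemma card_with_mult V q : V \subset ~: F -> q <= #|F| -> 0 < #|V| + q ->
  (ssum f V + g *+ q = 0)%R -> #|V| + q = r.
Proof.
move=> sVF /ex_subset_card[A sAF <-] Vq_gt0 sV.
have [cVA sVA] := sum_with_mult sVF sAF.
by rewrite -cVA; apply: sum0_card; rewrite ?sVA // -card_gt0 cVA.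
Qed.

Lemma structure_small_order :
  #[g]%g <= #|F| -> #|G| <= 2 * #|F| ->
  (#[g]%g = #|G| /\ F = setT) \/
  [/\ #|G| = 2 * #[g]%g, r = #[g]%g, forall i, i \notin F -> f i \notin <[g]>%g,
      odd #|~: F| /\ #|~: F| <= #[g]%g &
      forall i j, i \notin F -> j \notin F -> i != j -> (f i + f j = g *+ 2)%R].
Proof.
set o := #[g]%g; set h := #|F|; set n := #|G| => le_oh le_n2h.
have o_gt0 : 0 < o := order_gt0 g.
have go0 : (g *+ o = 0)%R by apply/eqP; rewrite mulrn_eq0_order.
have rE : r = o.
  by rewrite -(@card_with_mult set0 o) ?sub0set ?cards0 ?ssum0 ?add0r.
have cycV V : V \subset ~: F -> ssum f V \in <[g]>%g ->
    h + #|V| < 2 * o /\ ssum f V = (g *+ #|V|)%R.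
  move=> sVF; have [-> _|V0] := eqVneq V set0.
    rewrite ssum0 cards0 mulr0n addn0 ltnNge; split=> //; apply/negP => le2o.
    have : #|(set0 : {set I})| + 2 * o = r.
      apply: card_with_mult => //; rewrite ?sub0set ?cards0 ?muln_gt0 //.
      by rewrite ssum0 add0r mulnC mulrnA go0 mul0rn.
    by rewrite cards0; lia.
  rewrite -card_gt0 in V0; case/cycle_mulrn => c []; rewrite -/o => /andP[c0 le_co] sV.
  have cV : #|V| = c.
    have : #|V| + (o - c) = r.
      apply: card_with_mult => //; first by rewrite -/h; lia.
        by rewrite addn_gt0 V0.
      by rewrite sV -mulrnDr subnKC.
    lia.
  rewrite cV; split=> //; rewrite ltnNge; apply/negP => le2o.
  have : #|V| + (2 * o - c) = r.
    apply: card_with_mult => //; first by rewrite -/h; lia.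
      by rewrite addn_gt0 V0.
    by rewrite sV -mulrnDr subnKC ?(mulnC 2) ?mulrnA ?go0 ?mul0rn //; lia.
  lia.
pose P V := (V \subset ~: F) && (ssum f V \in <[g]>%g).
have P0 : P set0 by rewrite /P sub0set ssum0 group1.
(* When [V] is maximal, no nonempty set of the remaining terms outside [F] has its sum in [<g>], as
   [card_sums_mod] requires. *)
case: (@arg_maxnP _ set0 P (fun V => #|V|) P0) => V /andP[sVF sV] maxV.
have [lt_hV _] := cycV V sVF sV.
have := @card_sums_mod _ _ f <[g]>%G (~: F :\: V); rewrite -/n /= -orderE -/o.
have cW : #|~: F| = n - h by rewrite cardsCs setCK card_I.
have le_hn : h <= n by rewrite /n -card_I max_card.
rewrite cardsD (setIidPr sVF) cW => le_rest.
have {}le_rest : (n - h - #|V|).+1 * o <= n.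
  apply: le_rest => A; rewrite subsetD => /andP[sAF dAV] sA.
  apply/eqP; rewrite -cards_eq0 -leqn0.
  have : #|A :|: V| <= #|V|.
    by apply: maxV; rewrite /P subUset sAF sVF ssumU //; apply: groupM.
  by rewrite cardsU disjoint_setI0 // cards0 subn0; lia.
have /dvdnP[m nE] : o %| n by rewrite -[n]cardsT order_dvdG ?in_setT.
(* If [m > 2], the bounds [h + #|V| < 2 * o] and [n - h - #|V| < m] give [(m - 2) * (o - 1) < 1], so
   [o = 1]; then [h = 1] and [n <= 2]. *)
have m12 : m = 1 \/ m = 2.
  have n_gt0 : 0 < n by apply/card_gt0P; exists 0%R.
  have le_m : n - h - #|V| < m by rewrite -(ltn_pmul2r o_gt0) -nE; nia.
  have [le_m2 | lt_2m] := leqP m 2; first by case: m nE {le_m} le_m2 => [|[|[]]] //; lia.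
  have o1 : o = 1 by nia.
  by nia.
case: m12 => mE; [left | right]; move: nE; rewrite {m}mE => nE.
  split; first by rewrite nE mul1n.
  by apply/eqP; rewrite eqEcard subsetT cardsT card_I -/n nE mul1n.
have memW i : (i \in ~: F) = (i \notin F) by rewrite inE.
have nK i : i \notin F -> f i \notin <[g]>%g.
  move=> Fi; apply: contra (Fi) => fK; have [||_] := cycV [set i].
  - by rewrite sub1set memW.
  - by rewrite ssum1.
  by rewrite ssum1 cards1 mulr1n inE => ->.
have cG : #|G| = 2 * #|<[g]>%G| by rewrite -orderE.
have parity V' : V' \subset ~: F -> (ssum f V' \in <[g]>%g) = ~~ odd #|V'|.
  elim: {V'}_.+1 {-2}V' (ltnSn #|V'|) => // k IHk V' leVk sV'.
  have [-> | [i Vi]] := set_0Vmem V'; first by rewrite ssum0 cards0 group1.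
  have Fi : i \notin F by rewrite -memW (subsetP sV').
  rewrite -(setD1K Vi) ssumU1 ?setD11 // cardsU1 setD11 add1n /=.
  have : (ssum f (V' :\ i) \in <[g]>%g) = ~~ odd #|V' :\ i|.
    apply: IHk; last exact: subset_trans (subsetDl _ _) sV'.
    by move: leVk; rewrite (cardsD1 i) Vi.
  case: odd => /= [/negbT|] sVi; first exact: (index2_addP cG (nK i Fi)).
  by rewrite (groupMr _ sVi) (negPf (nK i Fi)).
split=> //.
- split; last by lia.
  (* If [#|~: F|] were even, [cycV] for the whole of [~: F] would yield
     [h + (n - h) < 2 * o = n]. *)
  apply: contraT; rewrite -cW -parity // => /(cycV _ (subxx _))[].
  by rewrite cW nE; lia.
move=> i j Fi Fj ij.
have [||_] := cycV [set i; j].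
- by rewrite subUset !sub1set !memW Fi.
- by rewrite ssumU1 ?inE // ssum1; apply: (index2_addP cG); apply: nK.
by rewrite ssumU1 ?inE // ssum1 cards2 ij.
Qed.

Lemma structure_large_order :
  #|F| < #[g]%g -> #|G| <= 2 * #|F| -> r <= #|F| -> #|G| <= 2 * r ->
  #[g]%g = #|G| /\
  [\/ exists i0, forall i, i != i0 -> f i = g,
      [/\ #|G| = 2 * r - 1, #|~: F| = 2 & forall i, i \notin F -> f i = (g *+ r)%R] |
      [/\ #|G| = 2 * r, odd #|~: F| & forall i, i \notin F -> f i = (g *+ r.+1)%R]].
Proof.
set h := #|F|; set n := #|G| => lt_ho le_n2h le_rh le_n2r.
have n_gt0 : 0 < n by apply/card_gt0P; exists 0%R.
have og : #[g]%g = n.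
  have := order_dvdG (in_setT g); rewrite cardsT -/n => /dvdnP[k nE].
  have : k < 2 by nia.
  by case: k nE => [|[|]] //; lia.
split=> //; rewrite og in lt_ho.
have [y yP] : exists y : I -> nat, forall i, 0 < y i <= n /\ f i = (g *+ y i)%R.
  apply: (@fin_all_exists _ (fun=> nat) (fun i y => 0 < y <= n /\ f i = (g *+ y)%R)).
  by move=> i; rewrite -og; apply: cycle_mulrn; rewrite order_card_cycle ?inE.
set W := ~: F; set w := #|W|.
have cW : w = n - h by rewrite /w /W cardsCs setCK card_I.
have memW i : (i \in W) = (i \notin F) by rewrite inE.
have y_gt1 i : i \in W -> 1 < y i.
  have [/andP[y0 _] fi] := yP i; rewrite memW inE fi => yn1.
  by rewrite ltn_neqAle y0 andbT; apply: contra yn1 => /eqP<-; rewrite mulr1n.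
have len V q k : V \subset W -> q <= h -> 0 < #|V| + q ->
    \sum_(i in V) y i + q = k * n -> #|V| + q = r.
  move=> sVW leq0 Vq yk; apply: card_with_mult => //.
  rewrite (@ssum_mulrn _ _ _ g y) => [|i _]; last by case: (yP i).
  by apply/eqP; rewrite -mulrnDr yk mulrn_eq0_order og dvdn_mull.
(* In this window, at most [h] copies of [g] are needed to complete the sum to [n]. *)
have win V : V \subset W -> 0 < #|V| ->
    n - h <= \sum_(i in V) y i <= n -> #|V| + n = r + \sum_(i in V) y i.
  move=> sVW V0 /andP[ge_h le_n].
  by have := len V (n - \sum_(i in V) y i) 1 sVW; lia.
have w_gt0 : 0 < w by lia.
have [/existsP[j0 /andP[Wj0 bigj0]] | nobig] := boolP [exists j in W, n - h <= y j].
  have big j : j \in W -> n - h <= y j -> y j = n - r + 1.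
    move=> Wj yj; have := win [set j]; rewrite sub1set cards1 big_set1 yj => /(_ Wj isT).
    by have [/andP[_ ->] _] := yP j; move/(_ isT); lia.
  (* A coefficient below [n - h], paired with that of [j0], lands in the window and would have to be
     1. *)
  have yW j : j \in W -> y j = n - r + 1.
    move=> Wj; have [/big->// | lt_y] := leqP (n - h) (y j).
    have ij : j \notin [set j0].
      by rewrite inE; apply: contraL lt_y => /eqP ->; rewrite -leqNgt.
    have := win [set j; j0]; rewrite subUset !sub1set Wj Wj0 cardsU1 ij cards1.
    rewrite big_setU1 //= big_set1 (big j0) //.
    by have := y_gt1 j Wj; move=> ? /(_ isT isT); lia.
  have fW i : i \notin F -> f i = (g *+ (n - r + 1))%R.
    by rewrite -memW => /yW <-; case: (yP i).
  have sumW V : V \subset W -> \sum_(i in V) y i = #|V| * (n - r + 1).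
    by move=> sVW; rewrite -sum_nat_const; apply: eq_bigr => i /(subsetP sVW)/yW.
  have [w1 | w_gt1] := leqP w 1.
    have /eqP/cards1P[i0 Wi0] : #|W| = 1 by rewrite -/w; lia.
    constructor 1; exists i0 => i; apply: contraNeq => fi.
    by rewrite -in_set1 -Wi0 memW inE.
  have [V2 sV2 cV2] := ex_subset_card w_gt1.
  (* If [n <= 2 * r - 2], the subtraction is not truncated and the coefficients sum to [n]; the
     length [2 * r - n] equals [r] only for [r = n], against [r <= h]. *)
  have pair := len V2 (2 * r - 2 - n) 1 sV2; rewrite sumW // cV2 in pair.
  have [le_nr | lt_nr] := leqP n (2 * r - 2); first by have := pair; lia.
  have [nE | nE] : n = 2 * r - 1 \/ n = 2 * r by lia.
    constructor 2; split=> // [|i Fi]; last by rewrite fW // (_ : n - r + 1 = r) //; lia.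
    apply/eqP; rewrite -/W -/w eqn_leq w_gt1 andbT leqNgt; apply/negP => w_gt2.
    have [V3 sV3 cV3] := ex_subset_card w_gt2.
    (* Since [3 * r + (r - 2) = 2 * n], this would be a zero-sum of length [r + 1]. *)
    have := len V3 (r - 2) 2 sV3; rewrite sumW // cV3; lia.
  constructor 3; split=> // [|i Fi]; last by rewrite fW // (_ : n - r + 1 = r.+1) //; lia.
  (* For even [w] the whole sequence would be a zero-sum, because
     [w * (r + 1) + h = (w / 2 + 1) * n]. *)
  apply: contraT => /even_halfK wE.
  have := len W h (w./2.+1) (subxx _); rewrite sumW // -/w -/W.
  by rewrite -{1 2}wE -mul2n; nia.
have small j : j \in W -> y j < w.
  move=> Wj; move: nobig; rewrite negb_exists => /forallP/(_ j).
  by rewrite Wj /= -ltnNge cW.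
pose P V := (V \subset W) && (w <= \sum_(i in V) y i).
have le2 V : V \subset W -> 2 * #|V| <= \sum_(i in V) y i.
  by move=> sVW; rewrite mulnC -sum_nat_const leq_sum // => i /(subsetP sVW)/y_gt1.
have PW : P W by rewrite /P subxx; have := le2 W (subxx _); rewrite -/w; lia.
(* Dropping any term of a minimal [V] takes its sum below [w]. All coefficients being below [w], the
   sum of [V] is below [2 * w <= n], hence in the window. *)
case: (@arg_minnP _ W P (fun V => #|V|) PW) => V /andP[sVW ge_w] minV.
have drop i : i \in V -> \sum_(j in V) y j = y i + \sum_(j in V :\ i) y j /\
    \sum_(j in V :\ i) y j < w.
  move=> Vi; split; first exact: big_setD1.
  rewrite ltnNge; apply/negP => ge_w'.
  have := minV (V :\ i); rewrite /P ge_w' (subset_trans (subsetDl _ _) sVW).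
  by rewrite (cardsD1 i V) Vi => /(_ isT); lia.
have [V0 | [i0 Vi0]] := set_0Vmem V; first by rewrite V0 big_set0 in ge_w; lia.
have Wi0 := subsetP sVW _ Vi0.
have cV : #|V| = #|V :\ i0|.+1 by rewrite (cardsD1 i0) Vi0.
have [sumV ltV] := drop i0 Vi0; have lt0 := small i0 Wi0.
have lenV : #|V| + n = r + \sum_(j in V) y j.
  by apply: win => //; lia.
(* Replacing [i] by [j] either stays in the window, which gives [y i = y j], or drops below [w]. In
   that case [j |: V] is in the window and [y j] would be 1. *)
have swap i j : i \in V -> j \in W -> j \notin V -> y i = y j.
  move=> Vi Wj Vj; have [sumVi ltVi] := drop i Vi.
  have [lt_i lt_j] := (small i (subsetP sVW _ Vi), small j Wj).
  have cVi : #|V| = #|V :\ i|.+1 by rewrite (cardsD1 i) Vi.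
  have jVi : j \notin V :\ i by rewrite !inE (negPf Vj) andbF.
  have y2 := y_gt1 j Wj.
  have := win (j |: V); rewrite subUset sub1set Wj sVW cardsU1 Vj big_setU1 //=.
  have := win (j |: (V :\ i)); rewrite subUset sub1set Wj cardsU1 jVi big_setU1 //=.
  by rewrite (subset_trans (subsetDl _ _) sVW) /= => /(_ isT isT) ? /(_ isT isT); lia.
have ltVW : #|V| < w.
  rewrite ltnNge; apply/negP => le_wV; have := le2 (V :\ i0) (subset_trans (subsetDl _ _) sVW).
  by have := y_gt1 i0 Wi0; lia.
have [j0 Wj0 Vj0] : exists2 j, j \in W & j \notin V.
  by apply/subsetPn; apply/negP => /subset_leq_card; rewrite -/w; lia.
have yW j : j \in W -> y j = y i0.
  move=> Wj; have [Vj | Vj] := boolP (j \in V); last by rewrite (swap i0 j).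
  by rewrite (swap j j0) // (swap i0 j0).
set x := y i0 in sumV lt0 yW.
have sumW V' : V' \subset W -> \sum_(i in V') y i = #|V'| * x.
  by move=> sVW'; rewrite -sum_nat_const; apply: eq_bigr => i /(subsetP sVW')/yW.
have x_gt1 : 1 < x := y_gt1 i0 Wi0.
have large : n < (#|V|).+1 * x.
  rewrite ltnNge; apply/negP => le_n; have := win (j0 |: V).
  rewrite subUset sub1set Wj0 sVW cardsU1 Vj0 sumW ?subUset ?sub1set ?Wj0 //.
  by rewrite cardsU1 Vj0 add1n => /(_ isT isT); rewrite sumW // in lenV ge_w *; lia.
rewrite sumW // in lenV ge_w.
rewrite (sumW _ (subset_trans (subsetDl _ _) sVW)) in ltV.
(* This follows from [(#|V| - 1) * x < w <= #|V| * x], [x < w], [2 * w <= n] and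
   [n < (#|V| + 1) * x]. *)
have cV2 : #|V| = 2 by nia.
rewrite cV2 in lenV ge_w large.
(* What remains is [g^4 (3g)^4] over a group of order 8, whose total sum is 0. *)
have x3 : x = 3 by lia.
have := len W h 2 (subxx _); rewrite sumW // -/w; lia.
Qed.

End MaxMult.

End LargeLength.

(** * Multisets and subgroups of index 2 *)

Local Open Scope fset_scope.
Local Open Scope mset_scope.
Local Open Scope nat_scope.

Lemma mset_nth (G : choiceType) (S : {mset G}) x0 a :
  S a = \sum_(i < size S) (nth x0 S i == a).
Proof.
rewrite -count_mem_mset -sum1_count big_mkcond /= (big_nth x0) big_mkord.
by apply: eq_bigr => i _; case: eqP.
Qed.

(** The bridge from subsequences to index sets: the terms at the positions in [A] form the required
    submultiset. *)
Lemma Sigma_ssum (G : finZmodType) (S : {mset G}) (A : {set 'I_(size S)}) :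
  Sigma #|A| S (ssum (fun i : 'I_(size S) => nth 0%R S i) A).
Proof.
set f := fun i : 'I_(size S) => nth 0%R S i.
have TE := perm_eq_seq_mset [seq f i | i <- enum A].
exists (seq_mset [seq f i | i <- enum A]); split.
- apply/msubsetP => a; rewrite mset_seqE (mset_nth S 0%R) count_map.
  rewrite -sum1_count big_mkcond big_enum /= [leqRHS](bigID (mem A)) /=.
  by apply/leq_trans/leq_addr/leq_sum => i _; rewrite /f /=; case: (_ == a).
- by rewrite (perm_size TE) size_map -cardE.
rewrite /sigma /ssum -big_enum /= -(big_map f xpredT id) -(perm_big _ TE) /=.
by rewrite big_mset; apply: eq_bigr.
Qed.

Lemma mset_two_valued (G : choiceType) (S : {mset G}) x0 (g b : G)
    (J : {set 'I_(size S)}) :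
  (forall i : 'I_(size S), nth x0 S i = if i \in J then b else g) ->
  S = (msetn (size S - #|J|) g `+` msetn #|J| b)%mset.
Proof.
move=> SJ; apply/msetP => a; rewrite msetE2 !msetnE (mset_nth S x0).
rewrite (bigID (mem J)) /= addnC; congr (_ + _).
  rewrite (eq_bigr (fun=> (g == a) : nat)) => [|i /negPf Ji]; last by rewrite SJ Ji.
  rewrite (eq_bigl (fun i => i \in ~: J)) => [|i]; last by rewrite in_setC.
  rewrite sum_nat_const cardsCs setCK card_ord eq_sym.
  by case: eqP; rewrite ?muln1 ?muln0.
rewrite (eq_bigr (fun=> (b == a) : nat)) => [|i Ji]; last by rewrite SJ Ji.
by rewrite sum_nat_const eq_sym; case: eqP; rewrite ?muln1 ?muln0.
Qed.

Lemma card_finsupp_two (G : choiceType) (S : {mset G}) (g b : G) k l :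
  S = (msetn k g `+` msetn l b)%mset -> #|` finsupp S| <= 2.
Proof.
move=> SE; have : (finsupp S `<=` [fset g; b])%fset.
  apply/fsubsetP => a; rewrite msuppE SE in_msetD !in_msetn !inE.
  by case/orP => /andP[_ /eqP ->]; rewrite eqxx ?orbT.
move/fsubset_leq_card/leq_trans; apply.
by rewrite cardfs2; case: (_ == _).
Qed.

(** The order of [e] is a proper multiple of [#[g]] that divides [2 * #[g]]. *)
Lemma order_notin_index2 (G : finZmodType) (g e : G) :
  #|G| = 2 * #[g]%g -> e \notin <[g]>%g -> g \in <[e]>%g -> #[e]%g = #|G|.
Proof.
move=> cG nge ge; have := order_dvdG (in_setT e); rewrite cardsT cG.
have /dvdnP[k ek] : #[g]%g %| #[e]%g by apply: cardSg; rewrite cycle_subG.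
have g_gt0 := order_gt0 g; rewrite ek dvdn_pmul2r // => /(@dvdn_leq _ 2 isT) le_k2.
have : #[g]%g < #[e]%g by apply: proper_card; rewrite properE !cycle_subG ge nge.
by rewrite ek; case: k le_k2 {ek} => [|[|[|k]]] //; lia.
Qed.

Lemma generator_order_card (G : finZmodType) (e : G) :
  #[e]%g = #|G| -> generator [set: G] e.
Proof. by move=> oe; rewrite /generator order_card_cycle. Qed.

Lemma cyclic_order_card (G : finZmodType) (e : G) :
  #[e]%g = #|G| -> cyclic [set: G].
Proof. by move=> oe; apply/cyclicP; exists e; rewrite order_card_cycle. Qed.

Lemma mem_cycle_mulrn (G : finZmodType) (g : G) k : (g *+ k)%R \in <[g]>%g.
Proof. by rewrite -zmodXgE mem_cycle. Qed.

(* Writing [2b = cg], translate [b] by a multiple [tg]: one can reach [c + 2t = 1]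
   modulo the order of [g] unless both are even, and then [c + 2t = 0]. *)
Lemma index2_cases (G : finZmodType) (g b : G) :
  #|G| = 2 * #[g]%g -> b \notin <[g]>%g ->
  (exists2 e : G, #[e]%g = #|G| & (e *+ 2 = g)%R) \/
  (~~ odd #[g]%g /\ exists2 h : G, h \notin <[g]>%g & (h *+ 2 = 0)%R).
Proof.
move=> cG nb; have [c [/andP[c0 le_c] b2]] : exists c, 0 < c <= #[g]%g /\ (b + b = g *+ c)%R.
  by apply: cycle_mulrn; apply: (@index2_addP _ <[g]>%G); rewrite -?orderE.
have nbt t : (b + g *+ t)%R \notin <[g]>%g.
  by apply: contra nb => bt; rewrite -(groupMr b (mem_cycle_mulrn g t)).
have bt2 t : ((b + g *+ t) *+ 2 = g *+ (c + t * 2))%R.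
  by rewrite mulrnDl mulr2n b2 -mulrnA -mulrnDr.
have root t : #[g]%g %| (c + t * 2).-1 -> exists2 e : G, #[e]%g = #|G| & (e *+ 2 = g)%R.
  move=> gt; have e2 : ((b + g *+ t) *+ 2 = g)%R.
    apply/eqP; rewrite bt2 -(prednK (_ : 0 < c + t * 2)) ?addn_gt0 ?c0 //.
    by rewrite mulrSr -subr_eq0 addrK mulrn_eq0_order.
  exists (b + g *+ t)%R => //; apply: order_notin_index2 (cG) (nbt t) _.
  by rewrite -{1}e2 mem_cycle_mulrn.
have [even_c | odd_c] := boolP (odd (#[g]%g + c)).
  left; apply: (root ((#[g]%g + 1 - c)./2)).
  suff -> : c + (#[g]%g + 1 - c)./2 * 2 = #[g]%g.+1 by [].
  lia.
have [odd_g | even_g] := boolP (odd #[g]%g).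
  left; apply: (root ((2 * #[g]%g + 1 - c)./2)).
  suff -> : c + (2 * #[g]%g + 1 - c)./2 * 2 = (2 * #[g]%g).+1 by rewrite dvdn_mull.
  lia.
right; split=> //; exists (b + g *+ ((#[g]%g - c)./2))%R => //.
apply/eqP; rewrite bt2 mulrn_eq0_order (_ : _ + _ = #[g]%g) //; lia.
Qed.

(** Multiplication by [#[g]] kills [<g>] and, [#[g]] being even, also [h]. It therefore kills the
    other coset too, and no element has order [2 * #[g]]. *)
Lemma involution_not_cyclic (G : finZmodType) (g h : G) :
  #|G| = 2 * #[g]%g -> ~~ odd #[g]%g -> h \notin <[g]>%g -> (h *+ 2 = 0)%R ->
  ~~ cyclic [set: G].
Proof.
move=> cG even_g nh h2; apply/cyclicP => -[c GE].
have oc : #[c]%g = #|G| by rewrite orderE -GE cardsT.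
have ho : (h *+ #[g]%g = 0)%R.
  by rewrite -(even_halfK even_g) -mul2n mulrnA h2 mul0rn.
have Ko a : a \in <[g]>%g -> (a *+ #[g]%g = 0)%R.
  by move=> /cycle_mulrn[k [_ ->]]; apply/eqP; rewrite -mulrnA mulrn_eq0_order dvdn_mull.
have : (c *+ #[g]%g == 0)%R.
  have [/Ko-> // | nc] := boolP (c \in <[g]>%g).
  have : (c + h)%R \in <[g]>%g by apply: (@index2_addP _ <[g]>%G); rewrite -?orderE.
  by move/Ko; rewrite mulrnDl ho addr0 => ->.
rewrite mulrn_eq0_order oc cG => /(dvdn_leq (order_gt0 g)).
by have := order_gt0 g; lia.
Qed.

Lemma isog_Zp_cycle (G : finZmodType) (g : G) p :
  1 < p -> #[g]%g = p -> <[g]>%g \isog [set: 'Z_p].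
Proof.
move=> p_gt1 og; rewrite isog_cyclic_card ?cycle_cyclic //.
rewrite cardsT card_ord Zp_cast // -og -orderE eqxx andbT.
by apply/cyclicP; exists Zp1; rewrite -Zp_cycle.
Qed.

Lemma dprod_involution (G : finZmodType) (g h : G) :
  #|G| = 2 * #[g]%g -> ~~ odd #[g]%g -> h \notin <[g]>%g -> (h *+ 2 = 0)%R ->
  [/\ #[h]%g = 2, (<[h]> \x <[g]>)%g = [set: G]
    & [set: G] \isog [set: 'Z_2 * 'Z_(#[g]%g)]].
Proof.
move=> cG even_g nh h2.
have oh : #[h]%g = 2.
  have : #[h]%g %| 2 by rewrite -mulrn_eq0_order h2.
  move/(@dvdn_leq _ 2 isT); have : #[h]%g != 1.
    by rewrite order_eq1; apply: contra nh => /eqP ->; apply: group1.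
  by have := order_gt0 h; lia.
have dG : (<[h]> \x <[g]>)%g = [set: G].
  have TI : (<[h]> :&: <[g]> = 1)%g.
    by apply: prime_TIg; rewrite -?orderE ?oh // cycle_subG.
  rewrite dprodE //; last first.
    exact: sub_abelian_cent2 (zmod_abelian [set: G]) (subsetT _) (subsetT _).
  by apply/eqP; rewrite eqEcard subsetT TI_cardMg // -!orderE oh cardsT cG leqnn.
split=> //.
have -> : [set: 'Z_2 * 'Z_(#[g]%g)] = setX [set: 'Z_2] [set: 'Z_(#[g]%g)].
  by apply/setP => x; rewrite !inE.
have g_gt1 : 1 < #[g]%g by have := order_gt0 g; case: #[g]%g even_g => [|[]].
apply: (@isog_dprod _ _ _ _ [set: G]%G _ _ _ dG (setX_dprod _ _)).
  by apply: isog_trans (isog_Zp_cycle _ oh) (isog_setX1 _ _).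
by apply: isog_trans (isog_Zp_cycle _ erefl) (isog_set1X _ _).
Qed.

(** * Reduction to at most two values *)

Section TwoValued.

Variables (G : finZmodType) (I : finType) (f : I -> G) (r : nat).

Hypothesis card_I : #|I| = #|G|.
Hypothesis sum0_card :
  forall A : {set I}, A != set0 -> ssum f A = 0%R -> #|A| = r.

(** A normal form common to cyclic and non-cyclic groups, sorted by the index of [<g>]; [J] marks
    the positions of the second value [b]. *)
Lemma two_valued_structure :
  exists (g b : G) (J : {set I}), (forall i, f i = if i \in J then b else g) /\
  [\/ #[g]%g = #|G| /\ #|J| <= 1,
      [/\ #|G| = 2 * #[g]%g, r = #[g]%g, b \notin <[g]>%g & #|J| = 1],
      [/\ #|G| = 2 * #[g]%g, r = #[g]%g, b \notin <[g]>%g, (b *+ 2 = g *+ 2)%R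
        & odd #|J| /\ #|J| <= #[g]%g] |
      #[g]%g = #|G| /\
      ([/\ #|G| = 2 * r - 1, #|J| = 2 & b = (g *+ r)%R] \/
       [/\ #|G| = 2 * r, odd #|J|, #|J| <= r & b = (g *+ r.+1)%R])].
Proof.
have single e i0 : (forall i, i != i0 -> f i = e) ->
    forall i, f i = if i \in [set i0] then f i0 else e.
  by move=> fe i; rewrite inE; case: eqP => [-> //|/eqP/fe].
have [small_r | large_r] := ltnP (2 * r) #|G|.
  have [e [i0 [oe fe]]] := structure_small_length card_I sum0_card small_r.
  exists e, (f i0), [set i0]; split; first exact: single.
  by constructor 1; rewrite cards1.
have [g le_rF] := length_le_mult card_I sum0_card.
set F := [set i | f i == g] in le_rF.
have fF i : i \in F -> f i = g by rewrite inE => /eqP.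
have le_2F : #|G| <= 2 * #|F| by lia.
have cW : #|~: F| = #|G| - #|F| by rewrite cardsCs setCK card_I.
have [small_o | large_o] := leqP #[g]%g #|F|.
  have [[og FT]|[cG rE nK [oddW leW] pair]] :=
      structure_small_order card_I sum0_card small_o le_2F.
    exists g, g, set0; split=> [i|]; first by rewrite inE fF // /F FT in_setT.
    by constructor 1; rewrite cards0.
  have [i0 Wi0] : exists i, i \in ~: F by apply/card_gt0P; case: #|_| oddW.
  have Fi0 : i0 \notin F by rewrite -in_setC.
  have [W1 | W_gt1] := leqP #|~: F| 1.
    have /eqP/cards1P[j0 WE] : #|~: F| = 1 by case: #|_| oddW W1 => [|[]].
    exists g, (f j0), [set j0]; rewrite cards1; split.
      by apply: single => i; rewrite -in_set1 -WE inE negbK => /fF.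
    by constructor 2; split=> //; apply: nK; rewrite -in_setC WE set11.
  (* An odd number above 1 is at least 3, so there is always a further [k] outside [F]; comparing
     pair sums with [f k] shows that [f] is constant there. *)
  have other i : exists2 k, k \in ~: F & (k != i) && (k != i0).
    have /subsetPn[k Wk] : ~~ (~: F \subset [set i; i0]).
      apply/negP => /subset_leq_card; rewrite cards2.
      by case: #|_| oddW W_gt1 => [|[|[|]]] //; case: (i != i0).
    by rewrite !inE negb_or; exists k.
  exists g, (f i0), (~: F); split=> [i|].
    have [Fi | Fi] := boolP (i \in F); first by rewrite inE Fi fF.
    rewrite inE Fi; have [k Wk /andP[ki ki0]] := other i.
    have Fk : k \notin F by rewrite -in_setC.
    by apply: (addrI (f k)); rewrite !pair.
  constructor 3; split=> //; first exact: nK.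
  have [k Wk /andP[_ ki0]] := other i0.
  have Fk : k \notin F by rewrite -in_setC.
  have [l Wl /andP[lk li0]] := other k.
  have Fl : l \notin F by rewrite -in_setC.
  have kE : f k = f i0 by apply: (addrI (f l)); rewrite !pair.
  by rewrite mulr2n -{1}kE pair.
have [og cases] := structure_large_order card_I sum0_card large_o le_2F le_rF large_r.
case: cases => [[i0 fi0] | [cG W2 fW] | [cG oddW fW]].
- exists g, (f i0), [set i0]; split; first exact: single.
  by constructor 1; rewrite cards1.
- exists g, (g *+ r)%R, (~: F); split=> [i|].
    by rewrite inE; have [/fF|/fW] := boolP (i \in F).
  by constructor 4; split=> //; left.
exists g, (g *+ r.+1)%R, (~: F); split=> [i|].
  by rewrite inE; have [/fF|/fW] := boolP (i \in F).
by constructor 4; split=> //; right; split=> //; lia.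
Qed.

End TwoValued.

(** * The non-cyclic and cyclic classifications *)

Theorem theorem3p4 (G : finZmodType) (n : nat) (S : {mset G}) (r : nat)
    (card_G : #|G| = n) (size_S : size S = n)
    (unique_r : unique (fun k : nat => 1 <= k <= n /\ Sigma k S 0%R) r) :
  [/\ #|` finsupp S| <= 2,
      ~~ cyclic [set: G] ->
        exists (g h : G) (m : nat),
          [/\ 1 <= m,
              [/\ 2 %| n, #[g]%g = n %/ 2, n %/ 2 = 2 * m, #[h]%g = 2
                & h \notin <[g]>%g],
              (<[h]> \x <[g]>)%g = [set: G]
                /\ [set: G] \isog [set: 'Z_2 * 'Z_(2 * m)],
              r = n %/ 2
            & [\/ exists g' : G,
                    g' \notin <[g]>%g /\ S = msetn (n - 1) g `+` [mset g'],
                  exists x : nat,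
                    [/\ odd x, 1 <= x <= n %/ 2 - 1
                      & S = msetn (n %/ 2 + x) g
                            `+` msetn (n %/ 2 - x) (h + g)%R]
                | exists x : nat,
                    [/\ odd x, 1 <= x <= n %/ 2 - 1
                      & S = msetn (n %/ 2 + x) g
                            `+` msetn (n %/ 2 - x)
                                  (h + g *+ ((n + 4) %/ 4))%R]]]
    & cyclic [set: G] ->
        exists2 g : G, generator [set: G] g &
          [\/ exists g' : G, S = msetn (n - 1) g `+` [mset g'],
              exists g'' : G,
                g'' \notin <[(g *+ 2)%R]>%g
                /\ S = msetn (n - 1) (g *+ 2)%R `+` [mset g''],
              [/\ odd n, r = (n + 1) %/ 2
                & S = msetn (n - 2) g `+` msetn 2 (g *+ ((n + 1) %/ 2))%R]
            | [/\ n = 2 %[mod 4], r = n %/ 2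
                & exists x : nat,
                    [/\ ~~ odd x, 0 <= x <= n %/ 2 - 1
                      & S = msetn (n %/ 2 + x) (g *+ 2)%R
                            `+` msetn (n %/ 2 - x) (g *+ ((n + 4) %/ 2))%R]]
              \/
              [/\ ~~ odd n, r = n %/ 2
                & exists x : nat,
                    [/\ 0 <= x <= n %/ 2 - 1, odd (n %/ 2 - x)
                      & S = msetn (n %/ 2 + x) g
                            `+` msetn (n %/ 2 - x)
                                  (g *+ ((n + 2) %/ 2))%R]]]].
Proof.
have n_gt0 : 0 < n by rewrite -card_G; apply/card_gt0P; exists 0%R.
pose f (i : 'I_(size S)) := nth 0%R S i.
have card_I : #|'I_(size S)| = #|G| by rewrite card_ord size_S card_G.
have sum0_card (A : {set 'I_(size S)}) : A != set0 -> ssum f A = 0%R -> #|A| = r.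
  move=> A0 sA; case: unique_r => _ /(_ #|A|) -> //; split; last first.
    by rewrite -sA; apply: Sigma_ssum.
  by rewrite card_gt0 A0 -card_G -card_I max_card.
have [g [b [J [/mset_two_valued SE cases]]]] := two_valued_structure card_I sum0_card.
rewrite card_G in cases; move: #|J| SE cases => j; rewrite size_S => SE cases.
split; first exact: card_finsupp_two SE.
- move=> noncyc.
  have noncyc_g : #[g]%g <> n.
    by rewrite -card_G => /cyclic_order_card; apply/negP.
  have split_g h : n = 2 * #[g]%g -> ~~ odd #[g]%g -> h \notin <[g]>%g -> (h *+ 2 = 0)%R ->
    [/\ 1 <= #[g]%g./2,
        [/\ 2 %| n, #[g]%g = n %/ 2, n %/ 2 = 2 * #[g]%g./2, #[h]%g = 2 & h \notin <[g]>%g]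
      & (<[h]> \x <[g]>)%g = [set: G] /\ [set: G] \isog [set: 'Z_2 * 'Z_(2 * #[g]%g./2)]].
    move=> nE even_g nh h2; have cG : #|G| = 2 * #[g]%g by rewrite card_G.
    have [oh dG isoG] := dprod_involution cG even_g nh h2.
    have gE : 2 * #[g]%g./2 = #[g]%g by rewrite mul2n even_halfK.
    by rewrite gE nE mulKn // dvdn_mulr //; split=> //; have := order_gt0 g; lia.
  case: cases => [[] // | [nE rE nb J1] | [nE rE nb b2 [oddJ leJ]] | [] //].
    have cG : #|G| = 2 * #[g]%g by rewrite card_G.
    case: (index2_cases cG nb) => [[e /cyclic_order_card cyc] | [even_g [h nh h2]]].
      by rewrite cyc in noncyc.
    have [? ? ?] := split_g h nE even_g nh h2.
    exists g, h, #[g]%g./2; split=> //; first by rewrite rE nE mulKn.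
    by constructor 1; exists b; rewrite {1}SE J1.
  have cG : #|G| = 2 * #[g]%g by rewrite card_G.
  have even_g : ~~ odd #[g]%g.
    case: (index2_cases cG nb) => [[e /cyclic_order_card cyc] | []] //.
    by rewrite cyc in noncyc.
  (* The choice [h = b - g] gives [h *+ 2 = 0] and [b = h + g]; then [x = #[g] - j] is odd because
     [#[g]] is even and [j] odd. *)
  have nh : (b - g)%R \notin <[g]>%g.
    by apply: contra nb => bg; rewrite -(groupMr b (groupVr (cycle_id g))).
  have h2 : ((b - g) *+ 2 = 0)%R by rewrite mulrnBl b2 subrr.
  have [? ? ?] := split_g (b - g)%R nE even_g nh h2.
  exists g, (b - g)%R, #[g]%g./2; split=> //; first by rewrite rE nE mulKn.
  have oE : n %/ 2 = #[g]%g by rewrite nE mulKn.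
  constructor 2; exists (#[g]%g - j); rewrite oE subrK subKn // {1}SE nE.
  have J_gt0 : 0 < j by case: (j) oddJ.
  have lt_J : j < #[g]%g.
    by rewrite ltn_neqAle leJ andbT; apply: contraNneq even_g => <-.
  by split; [rewrite oddB // oddJ addbT | lia | rewrite addnBA // addnn mul2n].
move=> cyc.
case: cases => [[og J1] | [nE rE nb J1] | [nE rE nb b2 [oddJ leJ]] | [og cases]].
- have gen_g : generator [set: G] g by apply: generator_order_card; rewrite card_G.
  exists g => //; constructor 1.
  (* For [j = 0] all terms equal [g], and [g' = g]. *)
  case: j J1 SE => [|[|//]] _ SE; last by exists b.
  exists g; rewrite SE msetn0 msetD0 subn0; apply/msetP => a.
  by rewrite msetE2 !msetnE; case: eqP => //; rewrite subnK.
- have cG : #|G| = 2 * #[g]%g by rewrite card_G.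
  case: (index2_cases cG nb) => [[e oe eg] | [even_g [h nh h2]]]; last first.
    by rewrite (negPf (involution_not_cyclic cG even_g nh h2)) in cyc.
  exists e; first exact: generator_order_card.
  by constructor 2; exists b; rewrite eg {1}SE J1.
- have cG : #|G| = 2 * #[g]%g by rewrite card_G.
  case: (index2_cases cG nb) => [[e oe eg] | [even_g [h nh h2]]]; last first.
    by rewrite (negPf (involution_not_cyclic cG even_g nh h2)) in cyc.
  have oE : n %/ 2 = #[g]%g by rewrite nE mulKn.
  have [z [/andP[z0 le_z] bgE]] : exists z, 0 < z <= #[e]%g /\ (b - g = e *+ z)%R.
    by apply: cycle_mulrn; rewrite order_card_cycle ?inE.
  (* As [b - g] doubles to 0, [#[g]] divides [z], while [z = 2 * #[g]] would mean [b = g]. *)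
  have zE : z = #[g]%g.
    have : (e *+ (z * 2) == 0)%R by rewrite mulrnA -bgE mulrnBl b2 subrr.
    rewrite mulrn_eq0_order oe cG mulnC dvdn_pmul2r // => /dvdnP[k kE].
    have : z != 2 * #[g]%g.
      apply: contra nb => /eqP zE; move: bgE.
      rewrite zE -cG -oe; have /eqP -> : (e *+ #[e]%g == 0)%R by rewrite mulrn_eq0_order.
      by move/subr0_eq->; apply: cycle_id.
    by rewrite oe cG in le_z; move: k kE => [|[|[|k]]]; nia.
  have bE : b = (e *+ ((n + 4) %/ 2))%R.
    have -> : (n + 4) %/ 2 = #[g]%g + 2 by rewrite nE -(mulnDr 2 _ 2) mulKn.
    by rewrite mulrnDr eg -zE -bgE subrK.
  (* For even [#[g]], the element [b - g = e *+ #[g]] would be a multiple of [e *+ 2 = g], putting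
     [b] in [<g>]. *)
  have odd_g : odd #[g]%g.
    apply: contraR nb => even_g; rewrite -(subrK g b) bgE zE.
    apply: groupM; last exact: cycle_id.
    by rewrite -(even_halfK even_g) -mul2n mulrnA eg mem_cycle_mulrn.
  exists e; first exact: generator_order_card.
  constructor 4; left; split; [by rewrite nE; lia | by rewrite oE |].
  exists (#[g]%g - j); rewrite oE subKn // -bE eg {1}SE nE.
  split; [by rewrite oddB // oddJ odd_g | by case: (j) oddJ leJ => //; lia |].
  by rewrite addnBA // addnn mul2n.
have gen_g : generator [set: G] g by apply: generator_order_card; rewrite card_G.
exists g => //; case: cases => [[nE J2 bE] | [nE oddJ leJ bE]].
  have r_gt0 : 0 < r by lia.
  have rE : (n + 1) %/ 2 = r by lia.
  by constructor 3; rewrite rE -bE {1}SE J2; split=> //; lia.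
constructor 4; right.
have rE : n %/ 2 = r by lia.
have r1E : (n + 2) %/ 2 = r.+1 by lia.
rewrite rE r1E -bE; split=> //; first by lia.
exists (r - j); rewrite subKn //; split=> //; first by case: (j) oddJ leJ => //; lia.
by rewrite {1}SE addnBA // addnn -mul2n -nE.
Qed.
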